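(* Let $X$ be a discrete metric space with bounded geometry. Then for every group $G$ and every $\omega\in Z^{3}(G,\mathrm{U}(1))$ whose class in $H^{3}(G,\mathrm{U}(1))$ is non-trivial, there is no $\omega$-anomalous action of $G$ on the Roe algebra $C^{*}(X)$.
   Context: A discrete (non-empty) metric space $X$ has bounded geometry if for every $R>0$ there is an $N$ such that every ball of radius $R$ in $X$ has at most $N$ elements. Let $H$ be a separable infinite dimensional Hilbert space; for $x\in X$ let $P_x$ be the projection of $\ell^{2}(X,H)$ onto the functions supported at $x$. An operator $T\in B(\ell^{2}(X,H))$ is locally compact if $P_yTP_x$ is compact for all $x,y\in X$, and has finite propagation if there is $R>0$ such that $P_yTP_x\neq 0$ implies $d(x,y)<R$. The Roe algebra $C^{*}(X)$ is the norm closure in $B(\ell^{2}(X,H))$ of the set of locally compact operators of finite propagation. $\mathrm{U}(1)$ is the group of complex numbers of modulus one, with trivial $G$-action. $Z^{3}(G,\mathrm{U}(1))$ is the group of normalized 3-cocycles: functions $\omega:G^{3}\to \mathrm{U}(1)$ with $\omega(g,h,k)=1$ whenever one of $g,h,k$ is $1$, and $\omega(gh,k,l)\,\omega(g,h,kl)=\omega(h,k,l)\,\omega(g,hk,l)\,\omega(g,h,k)$ for all $g,h,k,l\in G$. $H^{3}(G,\mathrm{U}(1))$ is the quotient of $Z^{3}(G,\mathrm{U}(1))$ by the coboundaries of normalized 2-cochains. For a group $G$, $\omega\in Z^{3}(G,\mathrm{U}(1))$ and a C*-algebra $B$ with multiplier algebra $M(B)$, an $\omega$-anomalous action of $G$ on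 $B$ is an assignment of a $*$-automorphism $\alpha_{g}\in\mathrm{Aut}(B)$ to each $g\in G$ and a unitary $m_{g,h}\in M(B)$ to each pair $g,h\in G$ such that (1) $m_{g,h}\,\alpha_{g}(\alpha_{h}(x))=\alpha_{gh}(x)\,m_{g,h}$ for all $x\in B$, and (2) $\omega(g,h,k)\,m_{gh,k}\,m_{g,h}=m_{g,hk}\,\alpha_{g}(m_{h,k})$ for all $g,h,k\in G$, where $\alpha_g$ also denotes its unique extension to $M(B)$. *)

(* Defs.v *)
From HB Require Import structures.
From mathcomp Require Import all_boot all_order all_algebra finmap.
From mathcomp Require Import sesquilinear complex.
From mathcomp Require Import boolp classical_sets functions cardinality reals.
From mathcomp Require Import topology normedtype.
From mathcomp Require Import ring lra.
From mathcomp Require summability.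

Set Implicit Arguments.
Unset Strict Implicit.
Unset Printing Implicit Defensive.

Import Order.TTheory GRing.Theory Num.Theory Num.Def.
Import numFieldNormedType.Exports.

Local Open Scope classical_set_scope.
Local Open Scope ring_scope.

HB.mixin Record CompleteNormedModule_isHilbert (R : realType) V
    & CompleteNormedModule R[i] V := {
  hdot : {dot V for @conjC R[i]};
  hdotE : forall x : V, hdot x x = `|x| ^+ 2
}.

#[short(type="hilbertType")]
HB.structure Definition Hilbert (R : realType) :=
  {V of CompleteNormedModule R[i] V & CompleteNormedModule_isHilbert R V}.

Section order_limits.
Context (K : numFieldType) (T : Type) (F : set_system T) {FF : ProperFilter F}.
Implicit Types (u : T -> K) (l M : K).

Lemma lim_ler u l M :
  u x @[x --> F] --> l -> (\forall x \near F, u x <= M) -> l <= M.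
Proof.
move=> ul uM; rewrite -subr_ge0; suff -> : M - l = `|M - l| by [].
have h1 : M - u x @[x --> F] --> M - l by apply: cvgB => //; exact: cvg_cst.
have h2 : `|M - u x| @[x --> F] --> `|M - l| by exact: cvg_norm.
apply: (norm_cvg_unique h1) => /=.
apply: cvg_trans h2; apply: near_eq_cvg.
near=> x; rewrite /= ger0_norm// subr_ge0.
by near: x; exact: uM.
Unshelve. all: by end_near. Qed.

Lemma lim_ger u l M :
  u x @[x --> F] --> l -> (\forall x \near F, M <= u x) -> M <= l.
Proof.
move=> ul uM; rewrite -lerN2; apply: (@lim_ler (fun x => - u x)).
  exact: cvgN.
by near=> x; rewrite lerN2; near: x; exact: uM.
Unshelve. all: by end_near. Qed.

End order_limits.

Section sums.
Context (X : choiceType) (C : numFieldType).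
Implicit Types (f g : X -> C) (l M : C).
Local Notation ps := summability.partial_sum.
Local Notation tot := (@summability.totally X).
#[local] Existing Instance summability.totally_filter.

Lemma psumE (V : zmodType) (f : X -> V) (A : {fset X}) :
  ps f A = \sum_(x <- A) f x.
Proof. by rewrite /ps big_seq_fsetE. Qed.

Lemma near_sub (A : {fset X}) : \forall B \near tot, fsubset A B.
Proof. by exists A. Qed.

Lemma psum_mono f (A B : {fset X}) : (forall x, 0 <= f x) ->
  fsubset A B -> ps f A <= ps f B.
Proof.
move=> f0 AB; rewrite !psumE (big_fsetID _ (mem A) B) /=.
rewrite (_ : [fset x | x in B & x \in A]%fset = A).
  by rewrite lerDl sumr_ge0.
apply/fsetP => x; rewrite !inE /= andbC; case: (boolP (x \in A)) => //= xA.
exact: (fsubsetP AB).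
Qed.

Lemma psum_le_lim f l : (forall x, 0 <= f x) -> ps f @ tot --> l ->
  forall A, ps f A <= l.
Proof.
move=> f0 fl A; apply: (lim_ger fl).
by apply: filterS (near_sub A) => B; exact: psum_mono.
Qed.

Lemma psumD (V : zmodType) (f g : X -> V) :
  ps (fun x => f x + g x) = ps f \+ ps g.
Proof. by apply/funext => A; rewrite /= !psumE big_split. Qed.

Lemma psumZ (a : C) f : ps (fun x => a * f x) = (fun A => a * ps f A).
Proof. by apply/funext => A; rewrite /= !psumE big_distrr. Qed.

Lemma is_cvg_psumD f g : cvg (ps f @ tot) -> cvg (ps g @ tot) ->
  cvg (ps (fun x => f x + g x) @ tot).
Proof. by move=> ? ?; rewrite psumD; exact: is_cvgD. Qed.

Lemma is_cvg_psumZ a f : cvg (ps f @ tot) -> cvg (ps (fun x => a * f x) @ tot).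
Proof. by move=> ?; rewrite psumZ; apply: is_cvgM => //; exact: is_cvg_cst. Qed.

Lemma cvg_psumD f g l m : ps f @ tot --> l -> ps g @ tot --> m ->
  ps (fun x => f x + g x) @ tot --> l + m.
Proof. by move=> ? ?; rewrite psumD; exact: cvgD. Qed.

Lemma cvg_psumZ a f l : ps f @ tot --> l -> ps (fun x => a * f x) @ tot --> a * l.
Proof. by move=> ?; rewrite psumZ; apply: cvgM => //; exact: cvg_cst. Qed.

Lemma psum_cvg_unique f l m : ps f @ tot --> l -> ps f @ tot --> m -> l = m.
Proof. by move=> fl fm; apply: (norm_cvg_unique fl). Qed.

End sums.

#[local] Existing Instance summability.totally_filter.
Lemma cvg_psum_conj (X : choiceType) (C : numClosedFieldType) (f : X -> C) l :
  summability.partial_sum f @ @summability.totally X --> l ->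
  summability.partial_sum (fun x => (f x)^*) @ @summability.totally X --> l^*.
Proof.
move=> fl; apply/cvgrPdist_lt => e e0; move/cvgrPdist_lt : fl => /(_ e e0).
by apply: filterS => A; rewrite !psumE -rmorph_sum -rmorphB norm_conjC.
Qed.

Section sums_complex.
Context (R : realType) (X : choiceType).
Local Notation C := R[i]^o.
Implicit Types f g : X -> C.
Local Notation ps := (summability.partial_sum (R := C)).
Local Notation tot := (@summability.totally X).
#[local] Existing Instance summability.totally_filter.

Lemma cvg_psum_ge0 f (M : R[i]) : (forall x, 0 <= f x) ->
  (forall A, ps f A <= M) -> cvg (ps f @ tot).
Proof.
move=> f0 fM.
pose S := [set complex.Re (ps f A) | A in setT].
have ps0 A : 0 <= ps f A by rewrite psumE sumr_ge0.
have psR A : ps f A = (complex.Re (ps f A))%:C%C.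
  by rewrite RRe_real// ger0_real.
have hS : has_sup S.
  split; first by exists (complex.Re (ps f fset0)), fset0.
  exists (complex.Re M) => _ [A _ <-].
  by have := fM A; rewrite lecE => /andP[].
apply/cvg_ex; exists (sup S)%:C%C.
apply/cvgrPdist_lt => e e0.
have eR : e = (complex.Re e)%:C%C by rewrite RRe_real// gtr0_real.
have e0' : 0 < complex.Re e by rewrite -ltcR -eR.
have [_ [A _ <-] hA] := sup_adherent e0' hS.
apply: filterS (near_sub A) => B AB.
have hB : ps f B <= (sup S)%:C%C.
  by rewrite psR lecR; apply: ub_le_sup; [exact: hS.2|exists B].
rewrite ger0_norm ?subr_ge0// ltrBlDr -ltrBlDl eR.
apply: lt_le_trans (psum_mono f0 AB).
by rewrite psR -rmorphB ltcR.
Qed.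

End sums_complex.

Section dot_norm.
Context (C : numClosedFieldType) (U : lmodType C) (dot : {dot U for @conjC C}).
Local Notation "''[' u , v ]" := (dot u v).

Lemma dot_conj u v : '[v, u] = '[u, v]^*.
Proof. by rewrite hermC expr0 mul1r. Qed.

Lemma dot_CauchySchwarz u v : `|'[u, v]| ^+ 2 <= '[u, u] * '[v, v].
Proof.
have [->|v0] := eqVneq v 0; first by rewrite !linear0r normr0 expr0n mulr0.
have vv : 0 < '[v, v] by rewrite dnorm_gt0.
have := dnorm_ge0 dot (u - ('[u, v] / '[v, v]) *: v).
rewrite dnormB dnormZ linearZr_LR /=.
set a := '[u, v]; set b := '[v, v].
have b0 : b != 0 by rewrite gt_eqF.
have bR : b^* = b by apply/CrealP/ger0_real/ltW.
have -> : `|a / b| ^+ 2 * b = `|a| ^+ 2 / b.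
  by rewrite normrM exprMn normfV (gtr0_norm vv) -/b; field.
have -> : (a / b)^* = a^* / b by rewrite rmorphM fmorphV /= bR.
have -> : (a^* / b * a)^* = a / b * a^* by rewrite !rmorphM fmorphV /= bR conjCK.
have -> : a^* / b * a + a / b * a^* = `|a| ^+ 2 / b + `|a| ^+ 2 / b.
  by rewrite normCK; field.
rewrite opprD addrA addrK subr_ge0 ler_pdivrMr//.
Qed.

Lemma dot_triangle u v :
  sqrtC '[u + v, u + v] <= sqrtC '[u, u] + sqrtC '[v, v].
Proof.
rewrite -ler_sqr ?nnegrE ?addr_ge0 ?sqrtC_ge0 ?dnorm_ge0//.
rewrite sqrtCK sqrrD !sqrtCK dnormD /= -addrA [leRHS]addrAC -addrA lerD2l lerD2l.
set a := '[u, v].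
have h : `|a| <= sqrtC '[u, u] * sqrtC '[v, v].
  rewrite -ler_sqr ?nnegrE ?mulr_ge0 ?sqrtC_ge0 ?dnorm_ge0//.
  by rewrite exprMn !sqrtCK dot_CauchySchwarz.
have -> : a + a^* = 2 * 'Re a by rewrite ReE; field.
rewrite -[leRHS]mulr_natl ler_pM2l ?ltr0n//; apply: le_trans h.
exact: (leif_Re_Creal a).
Qed.

End dot_norm.

Section l2_def.
Context (R : realType) (X : choiceType) (H : hilbertType R).
Local Notation ps := (summability.partial_sum (I := X)).
Local Notation tot := (@summability.totally X).
#[local] Existing Instance summability.totally_filter.

Definition square_summable : {pred X -> H} :=
  fun f => `[< cvg (ps (fun x => `|f x| ^+ 2 : R[i]^o) @ tot) >].

Lemma square_summableP f : f \in square_summable <->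
  exists M : R[i], forall A, ps (fun x => `|f x| ^+ 2) A <= M.
Proof.
have f0 (x : X) : 0 <= `|f x| ^+ 2 by rewrite exprn_ge0.
split=> [/asboolP/cvg_ex[l fl]|[M fM]].
  by exists l; apply: (psum_le_lim f0).
by apply/asboolP; exact: cvg_psum_ge0 fM.
Qed.

Lemma square_summable_submod_closed : submod_closed square_summable.
Proof.
split=> [|a f g /square_summableP[M fM] /square_summableP[N gN]].
  by apply/square_summableP; exists 0 => A; rewrite psumE big1// => x _; rewrite normr0 expr0n.
apply/square_summableP; exists (2 * (`|a| ^+ 2 * M) + 2 * N) => A.
apply: (@le_trans _ _ (2 * (`|a| ^+ 2 * ps (fun x => `|f x| ^+ 2) A) +
    2 * ps (fun x => `|g x| ^+ 2) A)).
  rewrite !psumE !mulr_sumr -big_split ler_sum//= => x _.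
  apply: (@le_trans _ _ ((`|a *: f x| + `|g x|) ^+ 2)).
    by rewrite lerXn2r ?nnegrE ?addr_ge0//; exact: ler_normD.
  rewrite normrZ -subr_ge0.
  rewrite [leRHS](_ : _ = (`|a| * `|f x| - `|g x|) ^+ 2); last by ring.
  by rewrite real_exprn_even_ge0// realB// ?realM// ger0_real.
by rewrite lerD// ler_wpM2l// ?ler_wpM2l// exprn_ge0.
Qed.

HB.instance Definition _ := GRing.isSubmodClosed.Build R[i] (X -> H)
  square_summable square_summable_submod_closed.

Record l2 := L2 { l2_fun :> X -> H ; _ : l2_fun \in square_summable }.

HB.instance Definition _ := [isSub for l2_fun].
HB.instance Definition _ := [Choice of l2 by <:].
HB.instance Definition _ := [SubChoice_isSubLmodule of l2 by <:].

Implicit Types f g h : l2.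

Lemma l2P f : l2_fun f \in square_summable. Proof. exact: valP. Qed.

Lemma l2_ext f g : (forall x, f x = g x) -> f = g.
Proof. by move=> fg; apply/val_inj/funext. Qed.

Lemma l2DE f g x : (f + g) x = f x + g x. Proof. by []. Qed.
Lemma l2ZE (a : R[i]) f x : (a *: f) x = a *: f x. Proof. by []. Qed.

Definition l2_dot f g : R[i] :=
  summability.sum (fun x => hdot (f x) (g x) : R[i]^o).

Lemma l2_sq_cvg f : cvg (ps (fun x => hdot (f x) (f x) : R[i]^o) @ tot).
Proof.
rewrite (_ : (fun x => _) = (fun x => `|f x| ^+ 2)); last first.
  by apply/funext => x; rewrite hdotE.
exact/asboolP/l2P.
Qed.

Lemma hdot_polarization (u v : H) : hdot u v = 4^-1 * (hdot (u + v) (u + v)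
  + (-1) * hdot (u + (-1) *: v) (u + (-1) *: v)
  + ('i * hdot (u + 'i *: v) (u + 'i *: v)
  + (- 'i) * hdot (u + (- 'i) *: v) (u + (- 'i) *: v))).
Proof.
rewrite !dnormD !dnormZ !linearZr_LR /= !(rmorphN, rmorphM, rmorph1) /= conjCi.
rewrite !(normrN, normrX, normr1, normCi) expr1n !mul1r.
have ii : 'i * 'i = -1 :> R[i] by rewrite -expr2 sqrCi.
set a := hdot u v; set b := a^*.
rewrite rmorphN /= conjCi.
move: (hdot u u) (hdot v v) a b ('i) ii => c d a b j jj.
transitivity (4^-1 * (2 * a + 2 * b - 2 * (j * j) * a + 2 * (j * j) * b)).
  by rewrite jj; field.
by field.
Qed.

Lemma l2_dot_cvg f g :
  ps (fun x => hdot (f x) (g x) : R[i]^o) @ tot --> (l2_dot f g : R[i]^o).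
Proof.
suff: cvg (ps (fun x => hdot (f x) (g x) : R[i]^o) @ tot) by [].
rewrite (_ : (fun x => _) = (fun x => 4^-1 * (hdot ((f + g) x) ((f + g) x) +
  (-1) * hdot ((f + (-1) *: g) x) ((f + (-1) *: g) x)
  + ('i * hdot ((f + 'i *: g) x) ((f + 'i *: g) x) +
  (- 'i) * hdot ((f + (- 'i) *: g) x) ((f + (- 'i) *: g) x))))); last first.
  by apply/funext => x; exact: hdot_polarization.
apply: is_cvg_psumZ; apply: is_cvg_psumD; apply: is_cvg_psumD.
- exact: l2_sq_cvg.
- by apply: is_cvg_psumZ; exact: l2_sq_cvg.
- by apply: is_cvg_psumZ; exact: l2_sq_cvg.
- by apply: is_cvg_psumZ; exact: l2_sq_cvg.
Qed.

Lemma l2_dot_lim f g (l : R[i]) :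
  ps (fun x => hdot (f x) (g x) : R[i]^o) @ tot --> (l : R[i]^o) ->
  l2_dot f g = l.
Proof. by move=> fgl; apply: psum_cvg_unique fgl; exact: l2_dot_cvg. Qed.

Lemma l2_dot_linear h : linear_for *%R (l2_dot^~ h).
Proof.
move=> a f g /=; apply: l2_dot_lim.
rewrite (_ : (fun x => _) = (fun x => a * hdot (f x) (h x) + hdot (g x) (h x))).
  by apply: cvg_psumD; [apply: cvg_psumZ|]; exact: l2_dot_cvg.
by apply/funext => x; rewrite l2DE linearDl l2ZE linearZl_LR.
Qed.

Lemma l2_dot_conj f g : l2_dot f g = (l2_dot g f)^*.
Proof.
apply: l2_dot_lim.
rewrite (_ : (fun x => _) = (fun x => (hdot (g x) (f x))^*)); last first.
  by apply/funext => x; exact: dot_conj.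
by apply: cvg_psum_conj; exact: l2_dot_cvg.
Qed.

Lemma l2_dot_bilinear : bilinear_for *%R (@conjC R[i] \; *%R) l2_dot.
Proof.
split=> [h|h a f g] /=; first exact: l2_dot_linear.
by rewrite l2_dot_conj l2_dot_linear rmorphD rmorphM /= -!l2_dot_conj.
Qed.

Lemma l2_dot_hermitian f g : l2_dot f g = (-1) ^+ false * (l2_dot g f)^*.
Proof. by rewrite mul1r -l2_dot_conj. Qed.

Lemma l2_dot_sq_cvg f :
  ps (fun x => `|f x| ^+ 2 : R[i]^o) @ tot --> (l2_dot f f : R[i]^o).
Proof.
rewrite (_ : (fun x => _) = (fun x => hdot (f x) (f x))).
  exact: l2_dot_cvg.
by apply/funext => x; rewrite hdotE.
Qed.

Lemma l2_dot_ge f (A : {fset X}) : ps (fun x => `|f x| ^+ 2) A <= l2_dot f f.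
Proof.
by apply: psum_le_lim => [x|]; [rewrite exprn_ge0|exact: l2_dot_sq_cvg].
Qed.

Lemma l2_dot_le f (M : R[i]) :
  (forall A, ps (fun x => `|f x| ^+ 2) A <= M) -> l2_dot f f <= M.
Proof.
by move=> fM; apply: (lim_ler (@l2_dot_sq_cvg f)); near=> A; exact: fM.
Unshelve. all: by end_near. Qed.

Lemma l2_dot_gt0 f : f != 0 -> 0 < l2_dot f f.
Proof.
move=> f0; have [x fx] : exists x, f x != 0.
  apply: contrapT => /forallNP fx; move/eqP: f0; apply; apply: l2_ext => x.
  by have /negP := fx x; rewrite negbK => /eqP.
apply: lt_le_trans (l2_dot_ge f [fset x]%fset).
by rewrite psumE big_seq_fset1 exprn_gt0// normr_gt0.
Qed.

HB.instance Definition _ := bilinear_isBilinear.Build R[i] l2 l2 R[i]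
  *%R (@conjC R[i] \; *%R) l2_dot l2_dot_bilinear.
HB.instance Definition _ :=
  isHermitianSesquilinear.Build R[i] l2 false conjC l2_dot l2_dot_hermitian.
HB.instance Definition _ := isDotProduct.Build R[i] l2 l2_dot l2_dot_gt0.

Definition l2_norm f : R[i] := sqrtC (l2_dot f f).

Lemma l2_ler_normD f g : l2_norm (f + g) <= l2_norm f + l2_norm g.
Proof. exact: (dot_triangle l2_dot). Qed.

Lemma l2_normrZ (a : R[i]) f : l2_norm (a *: f) = `|a| * l2_norm f.
Proof.
rewrite /l2_norm (dnormZ l2_dot) sqrtCM ?nnegrE ?exprn_ge0 ?(dnorm_ge0 l2_dot)//.
by rewrite -[in RHS](sqrCK (normr_ge0 a)).
Qed.

Lemma l2_normr0_eq0 f : l2_norm f = 0 -> f = 0.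
Proof. by move/eqP; rewrite (sqrt_dnorm_eq0 l2_dot) => /eqP. Qed.

HB.instance Definition _ := @Lmodule_isNormed.Build R[i] l2 l2_norm
  l2_ler_normD l2_normrZ l2_normr0_eq0.

Lemma l2_dotE f : l2_dot f f = `|f| ^+ 2.
Proof. by rewrite sqrtCK. Qed.

End l2_def.

Lemma ball_normP (K : numFieldType) (V : normedModType K) (x y : V) (e : K) :
  ball x e y <-> `|x - y| < e.
Proof. by rewrite -ball_normE. Qed.

Lemma cvg_psum_sq (K : numFieldType) (V : normedModType K) (X : choiceType)
    (T : Type) (F : set_system T) {FF : Filter F} (u : T -> X -> V) (l : X -> V)
    (A : {fset X}) : (forall x, u t x @[t --> F] --> l x) ->
  summability.partial_sum (fun x => `|u t x| ^+ 2) A @[t --> F] -->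
  summability.partial_sum (fun x => `|l x| ^+ 2) A.
Proof.
move=> ul; rewrite psumE; under eq_fun do rewrite psumE.
apply: cvg_big => [|x _]; first exact: add_continuous.
have ulx : `|u t x| @[t --> F] --> `|l x| by exact: cvg_norm.
under eq_fun do rewrite expr2.
exact: (cvgM ulx ulx).
Qed.

Section l2_complete.
Context (R : realType) (X : choiceType) (H : hilbertType R).
Local Notation ps := (summability.partial_sum (I := X)).
Implicit Types f g h : l2 X H.

Lemma l2_norm_le f (M : R[i]) : 0 <= M ->
  (forall A, ps (fun x => `|f x| ^+ 2) A <= M ^+ 2) -> `|f| <= M.
Proof.
move=> M0 fM; rewrite -ler_sqr ?nnegrE// -l2_dotE.
exact: l2_dot_le.
Qed.

Lemma l2_psum_le f (A : {fset X}) : ps (fun x => `|f x| ^+ 2) A <= `|f| ^+ 2.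
Proof. by rewrite -l2_dotE; exact: l2_dot_ge. Qed.

Lemma l2_coord_le f x : `|f x| <= `|f|.
Proof.
rewrite -ler_sqr ?nnegrE//; apply: le_trans (l2_psum_le f [fset x]%fset).
by rewrite psumE big_seq_fset1.
Qed.

Lemma l2_cauchy_cvg (F : set_system (l2 X H)) :
  ProperFilter F -> cauchy F -> cvg F.
Proof.
move=> FF /cauchyP Fc.
have cx x : cvg ((fun f => f x) @ F).
  apply: cauchy_cvg; apply/cauchyP => e e0.
  have [g Fg] := Fc e e0; exists (g x).
  suff: F [set h : l2 X H | ball (g x) e (h x)] by [].
  apply: filterS Fg => h /(ball_normP _ _ _).1 gh; apply/ball_normP.
  exact: (le_lt_trans (l2_coord_le (g - h) x) gh).
pose l x := lim ((fun f => f x) @ F).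
have lx x : (fun f => f x) @ F --> l x by exact: cx.
have key e g : 0 < e -> F (ball g e) ->
    forall A, ps (fun x => `|l x - g x| ^+ 2) A <= e ^+ 2.
  move=> e0 Fg A.
  apply: (@lim_ler _ _ F _ (fun h : l2 X H => ps (fun x => `|h x - g x| ^+ 2) A)).
    by apply: cvg_psum_sq => x; apply: cvgB; [exact: lx|exact: cvg_cst].
  apply: filterS Fg => h /(ball_normP _ _ _).1 gh.
  apply: (le_trans (l2_psum_le (h - g) A)).
  by rewrite ler_sqr ?nnegrE ?(ltW e0)// distrC ltW.
have l2l : l \in (@square_summable R X H).
  have [g Fg] := Fc 1 ltr01.
  rewrite -[l](subrK (l2_fun g)) rpredD ?l2P//.
  by apply/square_summableP; exists (1 ^+ 2) => A; exact: key.
apply/cvg_ex; exists (L2 l2l).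
apply/cvgrPdist_le => /= e e0.
have e20 : 0 < e / 2 by rewrite divr_gt0.
have [g Fg] := Fc _ e20.
have lg : `|(L2 l2l : l2 X H) - g| <= e / 2.
  by apply: l2_norm_le; [exact: ltW|exact: key].
apply: filterS Fg => h /(ball_normP _ _ _).1 gh.
rewrite -(subrK g (L2 l2l)) -addrA (le_trans (ler_normD _ _))//.
by rewrite (splitr e) lerD// ltW.
Qed.

HB.instance Definition _ := Uniform_isComplete.Build (l2 X H) l2_cauchy_cvg.
HB.instance Definition _ :=
  CompleteNormedModule_isHilbert.Build R (l2 X H) (@l2_dotE R X H).
End l2_complete.

Section bounded_operators.
Context (R : realType) (K : hilbertType R).
Implicit Types (x y : K).

Definition bounded_operator : {pred (K -> K)} := fun T =>
  `[< linear T /\ exists M : R[i], forall x, `|T x| <= M * `|x| >].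

Lemma bounded_operator_submod_closed : submod_closed bounded_operator.
Proof.
split=> [|a S T /asboolP[linS [M SM]] /asboolP[linT [N TN]]]; apply/asboolP.
  split=> [b x y|]; first by rewrite /= scaler0 addr0.
  by exists 0 => x; rewrite normr0 mul0r.
have E z : (a *: S + T) z = a *: S z + T z by [].
split=> [b x y|].
  rewrite !E linS linT.
  by rewrite !scalerDr !scalerA (mulrC a b) addrACA.
exists (`|a| * M + N) => x.
rewrite E (le_trans (ler_normD _ _))//.
by rewrite mulrDl lerD// normrZ -mulrA ler_wpM2l.
Qed.

HB.instance Definition _ := GRing.isSubmodClosed.Build R[i] (K -> K)
  bounded_operator bounded_operator_submod_closed.

Record bop := Bop { bop_fun :> K -> K ; _ : bop_fun \in bounded_operator }.

HB.instance Definition _ := [isSub for bop_fun].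
HB.instance Definition _ := [Choice of bop by <:].
HB.instance Definition _ := [SubChoice_isSubLmodule of bop by <:].

Implicit Types (S T U : bop).

Lemma bopP T : bop_fun T \in bounded_operator. Proof. exact: valP. Qed.

Lemma bop_linear T : linear T. Proof. by have /asboolP[] := bopP T. Qed.

HB.instance Definition _ T := GRing.isLinear.Build R[i] K K *:%R T (bop_linear T).

Lemma bop_ext S T : (forall x, S x = T x) -> S = T.
Proof. by move=> ST; apply/val_inj/funext. Qed.

Lemma bopDE S T x : (S + T) x = S x + T x. Proof. by []. Qed.
Lemma bopZE (a : R[i]) T x : (a *: T) x = a *: T x. Proof. by []. Qed.
Lemma bopNE T x : (- T) x = - T x. Proof. by []. Qed.
Lemma bopBE S T x : (S - T) x = S x - T x. Proof. by []. Qed.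

Lemma bop_bound T : exists2 M : R[i], 0 <= M & forall x, `|T x| <= M * `|x|.
Proof.
have /asboolP[_ [M TM]] := bopP T.
have [M0|M0] := boolP (0 <= M); first by exists M.
exists 0 => // x; have [->|x0] := eqVneq x 0; first by rewrite linear0 normr0 mul0r.
have := le_trans (normr_ge0 _) (TM x).
by rewrite pmulr_lge0 ?normr_gt0// (negbTE M0).
Qed.

Lemma idfun_bounded : (idfun : K -> K) \in bounded_operator.
Proof. by apply/asboolP; split=> //; exists 1 => x; rewrite mul1r. Qed.

Lemma comp_bounded S T : (S \o T) \in bounded_operator.
Proof.
apply/asboolP; split=> [a x y|]; first by rewrite /= !linearP.
have [M M0 SM] := bop_bound S; have [N N0 TN] := bop_bound T.
by exists (M * N) => x; rewrite (le_trans (SM _))// -mulrA ler_wpM2l.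
Qed.

Definition bop_one := Bop idfun_bounded.
Definition bop_mul S T := Bop (comp_bounded S T).

Lemma bop_mulA : associative bop_mul.
Proof. by move=> S T U; exact: bop_ext. Qed.
Lemma bop_mul1l : left_id bop_one bop_mul.
Proof. by move=> S; exact: bop_ext. Qed.
Lemma bop_mul1r : right_id bop_one bop_mul.
Proof. by move=> S; exact: bop_ext. Qed.
Lemma bop_mulDl : left_distributive bop_mul +%R.
Proof. by move=> S T U; exact: bop_ext. Qed.
Lemma bop_mulDr : right_distributive bop_mul +%R.
Proof. by move=> S T U; apply: bop_ext => x; rewrite /= linearD. Qed.

HB.instance Definition _ := GRing.Zmodule_isPzRing.Build bop
  bop_mulA bop_mul1l bop_mul1r bop_mulDl bop_mulDr.

Lemma bopME S T x : (S * T) x = S (T x). Proof. by []. Qed.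
Lemma bop1E x : (1 : bop) x = x. Proof. by []. Qed.

Let unit_values T : set R := [set complex.Re `|T x| | x in [set x | `|x| <= 1]].

Definition opnorm T : R[i] := (sup (unit_values T))%:C%C.

Lemma normReE (V : normedModType R[i]) (v : V) : `|v| = (complex.Re `|v|)%:C%C.
Proof. by rewrite RRe_real// ger0_real. Qed.

Let has_sup_unit_values T : has_sup (unit_values T).
Proof.
split; first by exists (complex.Re `|T 0|), 0 => //=; rewrite normr0.
have [M M0 TM] := bop_bound T; exists (complex.Re M) => _ [x /= x1 <-].
rewrite -lecR -normReE RRe_real ?ger0_real// (le_trans (TM x))//.
by rewrite ler_piMr.
Qed.

Lemma opnorm_ub T x : `|T x| <= opnorm T * `|x|.
Proof.
have [->|x0] := eqVneq x 0; first by rewrite linear0 !normr0 mulr0.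
have nx : 0 < `|x| by rewrite normr_gt0.
rewrite -ler_pdivrMr// mulrC.
have -> : `|x|^-1 * `|T x| = `|T (`|x|^-1 *: x)|.
  by rewrite linearZ normrZ normfV normr_id.
rewrite normReE lecR; apply: ub_le_sup; first exact: (has_sup_unit_values T).2.
by exists (`|x|^-1 *: x) => //=; rewrite normrZ normfV normr_id mulVf ?gt_eqF.
Qed.

Lemma opnorm_le T (M : R[i]) : 0 <= M -> (forall x, `|T x| <= M * `|x|) ->
  opnorm T <= M.
Proof.
move=> M0 TM; have MR : M = (complex.Re M)%:C%C by rewrite RRe_real ?ger0_real.
rewrite MR lecR; apply: ge_sup; first exact: (has_sup_unit_values T).1.
move=> _ [x /= x1 <-]; rewrite -lecR -MR -normReE (le_trans (TM x))//.
by rewrite ler_piMr.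
Qed.

Lemma opnorm_ge0 T : 0 <= opnorm T.
Proof.
rewrite ler0c; apply: ub_le_sup; first exact: (has_sup_unit_values T).2.
by exists 0; rewrite /= ?linear0 normr0.
Qed.

Lemma ler_opnormD S T : opnorm (S + T) <= opnorm S + opnorm T.
Proof.
apply: opnorm_le => [|x]; first by rewrite addr_ge0 ?opnorm_ge0.
by rewrite (le_trans (ler_normD _ _))// mulrDl lerD// opnorm_ub.
Qed.

Lemma opnormZ (a : R[i]) T : opnorm (a *: T) = `|a| * opnorm T.
Proof.
have le b S : opnorm (b *: S) <= `|b| * opnorm S.
  apply: opnorm_le => [|x]; first by rewrite mulr_ge0 ?opnorm_ge0.
  by rewrite normrZ -mulrA ler_wpM2l// opnorm_ub.
apply/eqP; rewrite eq_le le/=.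
have [->|a0] := eqVneq a 0; first by rewrite normr0 mul0r opnorm_ge0.
rewrite -ler_pdivlMl ?normr_gt0// -normfV.
by have := le a^-1 (a *: T); rewrite scalerA mulVf// scale1r.
Qed.

Lemma opnorm0_eq0 T : opnorm T = 0 -> T = 0.
Proof.
move=> T0; apply: bop_ext => x; apply/eqP; rewrite -normr_le0.
by rewrite (le_trans (opnorm_ub T x))// T0 mul0r.
Qed.

HB.instance Definition _ := @Lmodule_isNormed.Build R[i] bop opnorm
  ler_opnormD opnormZ opnorm0_eq0.

End bounded_operators.

Lemma addC_conj (C : numClosedFieldType) (a : C) : a + a^* = 2 * 'Re a.
Proof. by rewrite ReE; field. Qed.

Lemma cvg_conjC (C : numClosedFieldType) (T : Type) (F : set_system T)
    {FF : Filter F} (u : T -> C) (l : C) :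
  u x @[x --> F] --> l -> (u x)^* @[x --> F] --> l^*.
Proof.
move=> ul; apply/cvgrPdist_lt => e e0; move/cvgrPdist_lt : ul => /(_ e e0).
by apply: filterS => x; rewrite -rmorphB norm_conjC.
Qed.

Lemma cvg_normsqB_conj (C : numClosedFieldType) (V : normedModType C)
    (phi : V -> C) (M : C) (F : set_system V) {FF : Filter F} (z : V) :
  (forall x y, phi (x - y) = phi x - phi y) ->
  0 <= M -> (forall x, `|phi x| <= M * `|x|) -> F --> z ->
  `|y| ^+ 2 - (phi y + (phi y)^*) @[y --> F] --> `|z| ^+ 2 - (phi z + (phi z)^*).
Proof.
move=> phiB M0 phiM Fz.
have ncvg : `|y| @[y --> F] --> `|z| by exact: cvg_norm.
have pcvg : phi y @[y --> F] --> phi z.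
  apply/cvgrPdist_le => e e0.
  have M1 : 0 < M + 1 by rewrite ltr_wpDl.
  have /cvgrPdist_le /(_ (e / (M + 1))) := Fz.
  rewrite divr_gt0// => /(_ isT); apply: filterS => y zy.
  rewrite -phiB (le_trans (phiM _))//.
  apply: (@le_trans _ _ ((M + 1) * `|z - y|)).
    by rewrite ler_wpM2r// lerDl.
  by rewrite mulrC -ler_pdivlMr.
apply: cvgB; last by apply: cvgD => //; exact: cvg_conjC.
by under eq_fun do rewrite expr2; exact: (cvgM ncvg ncvg).
Qed.

Lemma complete_ex (T : completeType) (F : set_system T) :
  ProperFilter F -> cauchy F -> exists z : T, F --> z.
Proof. by move=> FF Fc; exists (lim F); exact: cauchy_cvg. Qed.

Section riesz.
Context (R : realType) (K : hilbertType R) (phi : K -> R[i]) (M : R[i]).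
Hypotheses (phi_lin : linear_for *%R phi) (M0 : 0 <= M).
Hypothesis phi_bound : forall x, `|phi x| <= M * `|x|.

Let phiD x y : phi (x + y) = phi x + phi y.
Proof. by rewrite -[x]scale1r phi_lin mul1r scale1r. Qed.
Let phi0 : phi 0 = 0.
Proof. by apply: (addrI (phi 0)); rewrite -phiD !addr0. Qed.
Let phiZ a x : phi (a *: x) = a * phi x.
Proof. by rewrite -[a *: x]addr0 phi_lin phi0 addr0. Qed.
Let phiN x : phi (- x) = - phi x.
Proof. by rewrite -scaleN1r phiZ mulN1r. Qed.

Let J x : R[i] := `|x| ^+ 2 - (phi x + (phi x)^*).
Let J_real x : J x \is Num.real.
Proof.
apply: realB; first by rewrite ger0_real// exprn_ge0.
by rewrite CrealE rmorphD /= conjCK addrC.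
Qed.

Let JE x : J x = (complex.Re (J x))%:C%C.
Proof. by rewrite RRe_real. Qed.

Let J_lb x : - M ^+ 2 <= J x.
Proof.
have h : phi x + (phi x)^* <= 2 * (M * `|x|).
  rewrite addC_conj ler_pM2l ?ltr0n//; apply: le_trans (phi_bound x).
  exact: (leif_Re_Creal (phi x)).
rewrite /J -subr_ge0 opprK.
apply: (@le_trans _ _ ((`|x| - M) ^+ 2)).
  by rewrite real_exprn_even_ge0// realB// ger0_real.
rewrite -subr_ge0 [X in 0 <= X](_ : _ = 2 * (M * `|x|) - (phi x + (phi x)^*)).
  by rewrite subr_ge0.
by ring.
Qed.

Let m := inf [set complex.Re (J x) | x in setT].

Let has_infJ : has_inf [set complex.Re (J x) | x in setT].
Proof.
split; first by exists (complex.Re (J 0)), 0.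
exists (complex.Re (- M ^+ 2)) => _ [x _ <-].
by have := J_lb x; rewrite lecE => /andP[].
Qed.

Let J_ge x : m%:C%C <= J x.
Proof. by rewrite JE lecR; apply: ge_inf; [exact: has_infJ.2|exists x]. Qed.

Let J_parallelogram x y :
  `|x - y| ^+ 2 = 2 * (J x + J y - 2 * J (2^-1 *: (x + y))).
Proof.
rewrite /J phiZ phiD rmorphM rmorphD fmorphV /= conjC_nat.
rewrite -!hdotE dnormB dnormZ dnormD /= normfV exprVn normr_nat.
by field.
Qed.

Let F : set_system K := filter_from [set e : R | 0 < e]
  (fun e => [set x | J x < (m + e)%:C%C]).

Let F_proper : ProperFilter F.
Proof.
apply: filter_from_proper; last first.
  move=> e /= e0; have [_ [x _ <-] xe] := inf_adherent e0 has_infJ.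
  by exists x => /=; rewrite JE ltcR.
apply: filter_from_filter; first by exists 1 => /=.
move=> d e /= d0 e0; exists (Num.min d e); first by rewrite /= lt_min d0.
by move=> x /= xde; split; apply: (lt_le_trans xde);
  rewrite lecR lerD2l ge_min lexx ?orbT.
Qed.

Let F_cauchy : cauchy F.
Proof.
apply/(@cauchyP _ _ F F_proper) => e e0.
have eE : e = (complex.Re e)%:C%C by rewrite RRe_real ?gtr0_real.
have e'0 : 0 < complex.Re e by rewrite -ltcR -eE.
pose d := complex.Re e ^+ 2 / 4.
have d0 : 0 < d by rewrite divr_gt0 ?exprn_gt0.
have [_ [x _ <-] xd] := inf_adherent d0 has_infJ.
exists x, d => //= y yd; apply/ball_normP.
rewrite -ltr_sqr ?nnegrE ?(ltW e0)// J_parallelogram.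
have {}xd : J x < (m + d)%:C%C by rewrite JE ltcR.
apply: (@lt_le_trans _ _ (2 * ((m + d)%:C%C + (m + d)%:C%C - 2 * m%:C%C))).
  rewrite ltr_pM2l ?ltr0n// ltr_leD ?ltrD// lerN2 ler_pM2l ?ltr0n//.
have -> : (m + d)%:C%C + (m + d)%:C%C - 2 * m%:C%C = 2 * d%:C%C :> R[i].
  by rewrite rmorphD; ring.
rewrite eE -rmorphXn /d rmorphM fmorphV /= rmorph_nat le_eqVlt; apply/orP; left.
by apply/eqP; field.
Qed.

Lemma riesz_representation : exists z, forall x, phi x = hdot x z.
Proof.
have [z Fz] : exists z : K, F --> z by exact: (complete_ex F_proper F_cauchy).
have FF : ProperFilter F := F_proper.
have Jz : J z <= m%:C%C.
  have Jcvg : J y @[y --> F] --> (J z : R[i]^o).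
    apply: (@cvg_normsqB_conj _ _ phi M F _ z _ M0 phi_bound Fz) => x y.
    by rewrite phiD phiN.
  rewrite JE lecR; apply/ler_addgt0Pr => e e0; rewrite -lecR -JE.
  by apply: (lim_ler Jcvg); exists e => // y /ltW.
exists z => x; apply/eqP; rewrite -subr_eq0 -oppr_eq0 opprB; apply/eqP.
move Dx: (hdot x z - phi x) => D; apply/eqP; apply: contraT => D0.
pose t := (1 + `|x| ^+ 2)^-1.
have t0 : 0 < t by rewrite invr_gt0 ltr_wpDr// exprn_ge0.
have := le_trans Jz (J_ge (z + (- t * D^*) *: x)).
rewrite /J phiD phiZ.
rewrite -!hdotE dnormD dnormZ linearZr_LR /=.
rewrite normrM normrN (gtr0_norm t0) norm_conjC.
have tR : t^* = t by apply/CrealP/ger0_real/ltW.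
have phx : phi x = hdot x z - D by rewrite -Dx; ring.
rewrite phx (dot_conj hdot x z) -subr_ge0.
rewrite !(rmorphD, rmorphM, rmorphN, rmorphB) /= !conjCK tR !hdotE exprMn normCK.
set a := hdot x z; set lhs := (X in 0 <= X).
have -> : lhs = t * (D * D^*) * (t * `|x| ^+ 2 - 2) by rewrite /lhs; ring.
have DD : 0 < t * (D * D^*).
  by rewrite mulr_gt0// -normCK exprn_gt0 ?normr_gt0.
have tx : t * `|x| ^+ 2 < 1.
  by rewrite /t mulrC ltr_pdivrMr ?ltr_wpDr ?exprn_ge0// mul1r ltrDr.
rewrite (pmulr_rge0 _ DD) subr_ge0 => /le_lt_trans /(_ tx).
by rewrite (ltr_nat _ 2 1).
Qed.
End riesz.

Section adjoint.
Context (R : realType) (K : hilbertType R).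
Implicit Types (S T : bop K) (x y : K).

Lemma hdot_le x y : `|hdot x y| <= `|x| * `|y|.
Proof.
rewrite -ler_sqr ?nnegrE ?mulr_ge0// exprMn -!hdotE.
exact: dot_CauchySchwarz.
Qed.

Lemma hdot_inj x y : (forall z, hdot z x = hdot z y) -> x = y.
Proof.
move=> xy; apply/eqP; rewrite -subr_eq0 -(dnorm_eq0 hdot).
by rewrite linearBr /= xy subrr.
Qed.

Lemma adj_ex T y : exists z, forall x, hdot (T x) y = hdot x z.
Proof.
apply: (@riesz_representation R K (fun x => hdot (T x) y) (opnorm T * `|y|)).
- by move=> a x z; rewrite linearP linearDl linearZl_LR.
- by rewrite mulr_ge0 ?opnorm_ge0.
- move=> x; rewrite (le_trans (hdot_le _ _))// mulrAC ler_wpM2r//.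
  exact: opnorm_ub.
Qed.

Definition adj_fun T y : K := sval (cid (adj_ex T y)).

Lemma adj_funP T x y : hdot (T x) y = hdot x (adj_fun T y).
Proof. by rewrite /adj_fun; case: cid. Qed.

Lemma adj_bounded T : adj_fun T \in @bounded_operator R K.
Proof.
apply/asboolP; split=> [a x y|].
  by apply: hdot_inj => z; rewrite -adj_funP linearDr linearZr_LR /=
    linearDr linearZr_LR /= -!adj_funP.
exists (opnorm T) => x; have [->|x0] := eqVneq (adj_fun T x) 0.
  by rewrite normr0 mulr_ge0 ?opnorm_ge0.
rewrite -(ler_pM2l (x := `|adj_fun T x|)) ?normr_gt0// -expr2 -hdotE.
rewrite -(ger0_norm (dnorm_ge0 hdot (adj_fun T x))) -adj_funP.
rewrite (le_trans (hdot_le _ _))// mulrA ler_wpM2r// mulrC; exact: opnorm_ub.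
Qed.

Definition adj T : bop K := Bop (adj_bounded T).

Lemma adjP T x y : hdot (T x) y = hdot x (adj T y).
Proof. exact: adj_funP. Qed.

Lemma adj_unique S T : (forall x y, hdot (T x) y = hdot x (S y)) -> adj T = S.
Proof.
by move=> TS; apply: bop_ext => y; apply: hdot_inj => x; rewrite -adjP TS.
Qed.

End adjoint.

Section hilbert_predicates.
Context (R : realType) (K : hilbertType R).

Definition separable := exists2 S : set K, countable S & dense S.

Definition finite_dimensional := exists n (e : 'I_n -> K), forall v,
  exists c : 'I_n -> R[i], v = \sum_(i < n) c i *: e i.

Definition compact_operator (T : bop K) :=
  precompact (T @` [set x | `|x| <= 1]).

End hilbert_predicates.

Section l2_projection.
Context (R : realType) (X : choiceType) (H : hilbertType R).
Implicit Types (f : l2 X H) (x y : X).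
Local Notation ps := (summability.partial_sum (I := X)).

Let res x f : X -> H := fun y => if y == x then f y else 0.

Let res_psum x f (A : {fset X}) :
  ps (fun y => `|res x f y| ^+ 2) A <= `|f| ^+ 2.
Proof.
apply: le_trans (l2_psum_le f A); rewrite !psumE ler_sum// => y _.
by rewrite /res; case: ifP => // _; rewrite normr0 expr0n exprn_ge0.
Qed.

Lemma l2_res_summable x f : res x f \in @square_summable R X H.
Proof.
by apply/square_summableP; exists (`|f| ^+ 2) => A; exact: res_psum.
Qed.

Lemma l2_res_bounded x :
  (fun f => L2 (l2_res_summable x f)) \in @bounded_operator R (l2 X H).
Proof.
apply/asboolP; split=> [a f g|].
  apply: l2_ext => y; rewrite l2DE l2ZE /= /res l2DE l2ZE.
  by case: ifP => // _; rewrite scaler0 addr0.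
exists 1 => f; rewrite mul1r; apply: l2_norm_le => // A; exact: res_psum.
Qed.

Definition l2_proj x : bop (l2 X H) := Bop (l2_res_bounded x).

Lemma l2_projE x f y : l2_proj x f y = if y == x then f y else 0.
Proof. by []. Qed.

End l2_projection.

Definition bounded_geometry (R : realType) (X : metricType R) :=
  forall r : R, 0 < r -> exists N : nat, forall x : X, (ball x r #<= `I_N)%card.

Section roe_algebra.
Context (R : realType) (X : metricType R) (H : hilbertType R).
Implicit Types T : bop (l2 X H).

Definition locally_compact_operator T := forall x y : X,
  compact_operator (l2_proj H y * T * l2_proj H x).

Definition finite_propagation T := exists2 r : R, 0 < r &
  forall x y : X, l2_proj H y * T * l2_proj H x != 0 -> mdist x y < r.

Definition roe_algebra : set (bop (l2 X H)) :=
  closure [set T | locally_compact_operator T /\ finite_propagation T].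

End roe_algebra.

(* C*-algebras are taken concretely, as sets A of operators on a Hilbert space
   K closed under the *-algebra operations and norm-closed.  A self-map of A is
   represented by a map bop K -> bop K, of which only the values on A matter. *)
Section multipliers.
Context (R : realType) (K : hilbertType R) (A : set (bop K)).
Implicit Types (S T : bop K) (a : bop K -> bop K).

Definition star_automorphism a :=
  [/\ set_bij A A a,
      {in A &, {morph a : S T / S + T}},
      forall c : R[i], {in A, {morph a : T / c *: T}},
      {in A &, {morph a : S T / S * T}} &
      {in A, {morph a : T / adj T}}].

(* Double centralizers: lmul m T stands for the product m T and rmul m T for
   T m.  Linearity and boundedness of both maps follow from the identity in
   is_multiplier (Busby), as does lmul m (S * T) = lmul m S * T. *)
Record multiplier := Multiplier {
  lmul : bop K -> bop K ;
  rmul : bop K -> bop K }.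

Implicit Types m n : multiplier.

Definition is_multiplier m :=
  [/\ {homo lmul m : T / A T}, {homo rmul m : T / A T} &
      {in A &, forall S T, S * lmul m T = rmul m S * T}].

Definition mult_eq m n :=
  {in A, lmul m =1 lmul n} /\ {in A, rmul m =1 rmul n}.

Definition mult_one := Multiplier id id.

Definition mult_mul m n := Multiplier (lmul m \o lmul n) (rmul n \o rmul m).

Definition mult_scale (c : R[i]) m :=
  Multiplier (fun T => c *: lmul m T) (fun T => c *: rmul m T).

Definition mult_star m :=
  Multiplier (fun T => adj (rmul m (adj T))) (fun T => adj (lmul m (adj T))).

Definition unitary_multiplier m :=
  [/\ is_multiplier m, mult_eq (mult_mul (mult_star m) m) mult_one &
      mult_eq (mult_mul m (mult_star m)) mult_one].

(* The extension of a to multipliers is the only one compatible with products: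
   a(m) a(T) = a(m T) and a(T) a(m) = a(T m) for T in A. *)
Definition mult_ext a m :=
  let ainv := 'pinv_(fun=> 0) A a in
  Multiplier (a \o lmul m \o ainv) (a \o rmul m \o ainv).

End multipliers.

Section cocycles.
Context (R : realType) (G : groupType).

Definition cocycle3 (w : G -> G -> G -> R[i]) :=
  [/\ forall g h k, `|w g h k| = 1,
      forall g h k, [\/ g = 1%g, h = 1%g | k = 1%g] -> w g h k = 1 &
      forall g h k l, w (g * h)%g k l * w g h (k * l)%g =
                      w h k l * w g (h * k)%g l * w g h k].

Definition normalized_cochain2 (c : G -> G -> R[i]) :=
  (forall g h, `|c g h| = 1) /\
  (forall g h, g = 1%g \/ h = 1%g -> c g h = 1).

Definition coboundary3 (w : G -> G -> G -> R[i]) :=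
  exists2 c, normalized_cochain2 c & forall g h k,
    w g h k = c h k * (c (g * h)%g k)^-1 * c g (h * k)%g * (c g h)^-1.

End cocycles.

Definition anomalous_action (R : realType) (G : groupType)
    (w : G -> G -> G -> R[i]) (K : hilbertType R) (A : set (bop K))
    (alpha : G -> bop K -> bop K) (m : G -> G -> multiplier K) :=
  [/\ forall g, star_automorphism A (alpha g),
      forall g h, unitary_multiplier A (m g h),
      forall g h T, A T ->
        lmul (m g h) (alpha g (alpha h T)) = rmul (m g h) (alpha (g * h)%g T) &
      forall g h k,
        mult_eq A (mult_scale (w g h k) (mult_mul (m (g * h)%g k) (m g h)))
                  (mult_mul (m g (h * k)%g) (mult_ext A (alpha g) (m h k)))].

(* Main.v *)
Require Import Defs.
From HB Require Import structures.
From mathcomp Require Import all_boot all_order all_algebra.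
From mathcomp Require Import complex.
From mathcomp Require Import boolp classical_sets functions cardinality reals.
From mathcomp Require Import topology normedtype.
From mathcomp Require Import sesquilinear finmap.
From mathcomp Require Import ring.
From mathcomp Require summability.

Set Implicit Arguments.
Unset Strict Implicit.
Unset Printing Implicit Defensive.
Local Open Scope classical_set_scope.
Local Open Scope ring_scope.

Import Order.TTheory GRing.Theory Num.Theory Num.Def.
Import numFieldNormedType.Exports.

(** The Roe algebra contains every rank-one operator on the Hilbert space
K = l2(X, H) ([rank_one_roe]), hence acts irreducibly on K and contains the
compact operators.  Automorphisms of such an algebra come from unitaries of K,
and since unitaries compose associatively, the anomaly is trivial in cohomology.

Let A be a set of operators on K != 0 that contains the rank-one operators.

- Every *-automorphism of A is spatial ([automorphism_spatial]).  A rank-one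
  projection p satisfies p A p = C p.  This property passes to its image q,
  and q A q = C q forces q to have rank one because A contains rank-one
  operators.  If p and q are the projections onto the unit vectors e and f,
  then x |-> alpha(|x><e|) f is a unitary that implements alpha.

- Every multiplier of A is an operator M on K ([lmulE], [rmulE]), and M is
  isometric when the multiplier is unitary ([mult_op_isometry]).

An anomalous action therefore yields unitaries U_g and isometries M_(g,h) of K.
Axiom (1) says that M_(g,h) U_g U_h and U_(gh) implement the same map of A, so
they differ by a scalar c(g,h) of modulus one, as only scalars commute with all
rank-one operators ([intertwining_scalar]).  Evaluated on U_g U_h U_k, axiom (2)
becomes w(g,h,k) c(g,h) c(gh,k) = c(h,k) c(g,hk)
([action_cochain_relation]), so w is the coboundary of c.  The normalization of
w makes c(1,k) = c(g,1) one constant; dividing c by it gives a normalized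
cochain with the same coboundary. *)

(** * Rank-one operators *)

Section rank_one.
Context (R : realType) (K : hilbertType R).
Implicit Types (x y z : K) (T : bop K).

Lemma rank_one_bounded x y :
  (fun z => hdot z y *: x) \in @bounded_operator R K.
Proof.
apply/asboolP; split=> [a u v|].
  by rewrite linearDl linearZl_LR scalerDl scalerA.
exists (`|y| * `|x|) => z.
by rewrite normrZ mulrAC ler_wpM2r// (le_trans (hdot_le _ _))// mulrC.
Qed.

Definition rank_one x y : bop K := Bop (rank_one_bounded x y).

Lemma rank_oneE x y z : rank_one x y z = hdot z y *: x.
Proof. by []. Qed.

Lemma rank_one_norm x y : `|rank_one x y| <= `|x| * `|y|.
Proof.
apply: opnorm_le => [|z]; first by rewrite mulr_ge0.
rewrite rank_oneE normrZ mulrC -mulrA ler_wpM2l// mulrC.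
exact: hdot_le.
Qed.

Lemma rank_oneDl x x' y : rank_one (x + x') y = rank_one x y + rank_one x' y.
Proof. by apply: bop_ext => z; rewrite bopDE !rank_oneE scalerDr. Qed.

Lemma rank_oneZl (a : R[i]) x y : rank_one (a *: x) y = a *: rank_one x y.
Proof. by apply: bop_ext => z; rewrite bopZE !rank_oneE !scalerA mulrC. Qed.

Lemma rank_oneBl x x' y : rank_one (x - x') y = rank_one x y - rank_one x' y.
Proof. by apply: bop_ext => z; rewrite bopBE !rank_oneE scalerBr. Qed.

Lemma rank_oneBr x y y' : rank_one x (y - y') = rank_one x y - rank_one x y'.
Proof.
by apply: bop_ext => z; rewrite bopBE !rank_oneE linearBr scalerBl.
Qed.

Lemma mul_rank_one T x y : T * rank_one x y = rank_one (T x) y.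
Proof. by apply: bop_ext => z; rewrite bopME !rank_oneE linearZ. Qed.

Lemma rank_one_mul T x y : rank_one x y * T = rank_one x (adj T y).
Proof. by apply: bop_ext => z; rewrite bopME !rank_oneE adjP. Qed.

Lemma adj_rank_one x y : adj (rank_one x y) = rank_one y x.
Proof.
apply: adj_unique => u v.
by rewrite !rank_oneE linearZl_LR linearZr_LR /= mulrC (dot_conj hdot v x).
Qed.

Lemma adjK T : adj (adj T) = T.
Proof.
by apply: adj_unique => x y; rewrite dot_conj -adjP -dot_conj.
Qed.

Lemma unit_vector_dot (e : K) : `|e| = 1 -> hdot e e = 1.
Proof. by rewrite hdotE => ->; rewrite expr1n. Qed.

End rank_one.

(** * Operator sets that contain the rank-one operators *)

Section spatial.
Context (R : realType) (K : hilbertType R) (A : set (bop K)).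
Hypothesis A1 : forall x y, A (rank_one x y).
Variable e : K.
Hypothesis e1 : `|e| = 1.
Implicit Types (x y z : K) (S T : bop K).

Lemma rank_one_sep x y : (forall a b, rank_one a b x = rank_one a b y) -> x = y.
Proof.
move=> xy; apply/eqP; rewrite -subr_eq0 -(dnorm_eq0 hdot); apply/eqP.
have := xy e (x - y); rewrite !rank_oneE => /eqP.
rewrite -subr_eq0 -scalerBl scaler_eq0 => /orP[/eqP|].
  by rewrite -linearBl.
by rewrite -normr_eq0 e1 oner_eq0.
Qed.

(** The operators U are kept as plain functions: a surjective linear map that
preserves the inner product is a unitary. *)
Definition implements (U : K -> K) (a : bop K -> bop K) :=
  [/\ linear U, forall x y, hdot (U x) (U y) = hdot x y,
      forall y, exists x, U x = y &
      forall T, A T -> forall x, a T (U x) = U (T x)].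

Section automorphism.
Variable a : bop K -> bop K.
Hypothesis a_aut : star_automorphism A a.

Let aA T : A T -> A (a T).
Proof. by case: a_aut => -[+ _ _] _ _ _ _; apply. Qed.
Let a_surj T : A T -> exists2 S, A S & a S = T.
Proof. by case: a_aut => -[_ _ +] _ _ _ _ => h /h. Qed.
Let a_inj S T : A S -> A T -> a S = a T -> S = T.
Proof.
by move=> AS AT; case: a_aut => -[_ h _] _ _ _ _; apply: h; exact: mem_set.
Qed.
Let aD S T : A S -> A T -> a (S + T) = a S + a T.
Proof. by move=> AS AT; case: a_aut => _ h _ _ _; apply: h; exact: mem_set. Qed.
Let aZ c T : A T -> a (c *: T) = c *: a T.
Proof. by move=> AT; case: a_aut => _ _ h _ _; apply: h; exact: mem_set. Qed.
Let aM S T : A S -> A T -> a (S * T) = a S * a T.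
Proof. by move=> AS AT; case: a_aut => _ _ _ h _; apply: h; exact: mem_set. Qed.
Let aadj T : A T -> a (adj T) = adj (a T).
Proof. by move=> AT; case: a_aut => _ _ _ _ h; apply: h; exact: mem_set. Qed.

Let p := rank_one e e.
Let q := a p.
Let Ap : A p. Proof. exact: A1. Qed.
Let pp : p * p = p.
Proof. by rewrite /p mul_rank_one rank_oneE unit_vector_dot// scale1r. Qed.
Let qq : q * q = q. Proof. by rewrite /q -aM// pp. Qed.
Let q_adj : adj q = q. Proof. by rewrite /q -aadj// adj_rank_one. Qed.

Let rank0 x : rank_one 0 x = 0.
Proof. by apply: bop_ext => z; rewrite rank_oneE scaler0. Qed.

Let q0 : q != 0.
Proof.
apply/eqP => q0.
have A0 : A 0 by rewrite -(rank0 e).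
have a0 : a 0 = 0 by have := aZ 0 A0; rewrite !scale0r.
have /a_inj p0 : a p = a 0 by rewrite a0.
have {}p0 : p = 0 by exact: p0.
have : p e = 0 by rewrite p0.
rewrite rank_oneE unit_vector_dot// scale1r => /eqP.
by rewrite -normr_eq0 e1 oner_eq0.
Qed.

(* Minimality of a projection is a property of the algebra alone, which is why
   it passes from p to its image q. *)
Let q_corner T : A T -> exists c : R[i], q * T * q = c *: q.
Proof.
move=> /a_surj[S AS <-]; exists (hdot (S e) e).
rewrite /q -mulrA -!aM//; last first.
- by rewrite mul_rank_one.
rewrite -aZ//; congr a.
by rewrite !mul_rank_one rank_oneE rank_oneZl.
Qed.

(** If q x != 0, then q |x><x| q = |qx><qx| is a scalar multiple of q, because
q A q = C q; so the range of q is the line through q x. *)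
Lemma automorphism_minimal_projection : exists2 f, `|f| = 1 & q = rank_one f f.
Proof.
have [x qx] : exists x, q x != 0.
  apply: contrapT => /forallNP h; move/eqP: q0; apply; apply: bop_ext => x.
  by have /negP := h x; rewrite negbK => /eqP.
have [c] := q_corner (A1 x x).
rewrite mul_rank_one rank_one_mul q_adj => qc.
have qqx : q (q x) = q x by rewrite -bopME qq.
have nx : `|q x| != 0 by rewrite normr_eq0.
(* q fixes q x, so evaluating both sides at q x determines the scalar. *)
have cE : c = `|q x| ^+ 2.
  have : rank_one (q x) (q x) (q x) = c *: q x by rewrite qc bopZE qqx.
  rewrite rank_oneE hdotE => /eqP; rewrite -subr_eq0 -scalerBl scaler_eq0.
  by rewrite (negbTE qx) orbF subr_eq0 => /eqP.
exists (`|q x|^-1 *: q x).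
  by rewrite normrZ normfV normr_id mulVf.
apply: bop_ext => z; rewrite rank_oneE linearZr_LR /= scalerA.
have : rank_one (q x) (q x) z = c *: q z by rewrite qc.
rewrite rank_oneE cE => h.
rewrite fmorphV /= (CrealP (ger0_real _))// mulrAC -invfM -expr2 -scalerA h.
by rewrite scalerA mulVf ?scale1r// expf_neq0.
Qed.

(** The left ideal A p is a copy of K, through |x><e| |-> x, and alpha carries
it to A q, a copy of K in the same way; the unitary is the resulting map. *)
Lemma automorphism_spatial : exists U, implements U a.
Proof.
have [f f1 qf] := automorphism_minimal_projection.
have aq : a p f = f by rewrite -/q qf rank_oneE unit_vector_dot// scale1r.
exists (fun x => a (rank_one x e) f); split.
- move=> c x y; rewrite rank_oneDl rank_oneZl aD ?aZ//.
  by rewrite -rank_oneZl.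
- move=> x y; rewrite dot_conj adjP -aadj// adj_rank_one -dot_conj -bopME -aM//.
  rewrite mul_rank_one rank_oneE rank_oneZl aZ//.
  by rewrite bopZE aq linearZl_LR /= unit_vector_dot// mulr1.
(* The preimage S of |y><f| gives alpha(S p) f = |y><f| f = y. *)
- move=> y; have [S AS aS] := a_surj (A1 y f).
  exists (S e); rewrite -mul_rank_one aM// bopME aq aS rank_oneE.
  by rewrite unit_vector_dot// scale1r.
- by move=> T AT x; rewrite -mul_rank_one aM.
Qed.

End automorphism.

Section multiplier.
Variable m : multiplier K.
Hypothesis m_mul : is_multiplier A m.

Let lA T : A T -> A (lmul m T). Proof. by case: m_mul => h _ _ /h. Qed.
Let rA T : A T -> A (rmul m T). Proof. by case: m_mul => _ h _ /h. Qed.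
Let lr S T : A S -> A T -> S * lmul m T = rmul m S * T.
Proof. by move=> AS AT; case: m_mul => _ _ h; apply: h; exact: mem_set. Qed.

(* Left multiplication by rank-one operators separates operators, which turns
   the double centralizer identity into right A-linearity. *)
Let lmulM S T : A S -> A T -> A (S * T) -> lmul m (S * T) = lmul m S * T.
Proof.
move=> AS AT AST; apply: bop_ext => x; apply: rank_one_sep => y z.
by rewrite -!bopME lr// !mulrA lr.
Qed.

(** The operator on K that a multiplier is: m acts on the vector x through
|x><e|, whose value at e is x. *)
Definition mult_op x : K := lmul m (rank_one x e) e.

Lemma lmul_rank_one x y : lmul m (rank_one x y) = rank_one (mult_op x) y.
Proof.
have -> : rank_one x y = rank_one x e * rank_one e y.
  by rewrite mul_rank_one rank_oneE unit_vector_dot// scale1r.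
by rewrite lmulM// ?mul_rank_one.
Qed.

Lemma lmulE T x : A T -> lmul m T x = mult_op (T x).
Proof.
move=> AT; have {1}-> : x = rank_one x e e.
  by rewrite rank_oneE unit_vector_dot// scale1r.
by rewrite -bopME -lmulM// mul_rank_one.
Qed.

Lemma rmulE T x : A T -> rmul m T x = T (mult_op x).
Proof.
move=> AT; have {1}-> : x = rank_one x e e.
  by rewrite rank_oneE unit_vector_dot// scale1r.
by rewrite -bopME -lr.
Qed.

Lemma mult_op_linear : linear mult_op.
Proof.
move=> c x y; apply: rank_one_sep => u v.
by rewrite bop_linear -!rmulE// bop_linear.
Qed.

(** m^* m = 1, applied to |y><e|, reads |e><My| M = |e><y| after taking
adjoints. *)
Lemma mult_op_isometry : unitary_multiplier A m ->
  forall x y, hdot (mult_op x) (mult_op y) = hdot x y.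
Proof.
case=> _ [h _] _ x y.
have /= := h (rank_one y e) (mem_set (A1 y e)).
rewrite lmul_rank_one adj_rank_one => /(congr1 (@adj R K)).
rewrite adjK adj_rank_one => E.
have := congr1 (fun T : bop K => T x) E.
rewrite rmulE// !rank_oneE => /eqP; rewrite -subr_eq0 -scalerBl scaler_eq0.
by rewrite -[e == 0]normr_eq0 e1 oner_eq0 orbF subr_eq0 => /eqP.
Qed.

End multiplier.

(** The commutant of the rank-one operators is scalar: W x = W |x><e| e =
|x><e| W e = <We, e> x. *)
Lemma commutant_rank_one (W : K -> K) :
  (forall x y z, W (rank_one x y z) = rank_one x y (W z)) ->
  exists c : R[i], forall x, W x = c *: x.
Proof.
move=> h; exists (hdot (W e) e) => x.
by have := h x e e; rewrite !rank_oneE unit_vector_dot// scale1r.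
Qed.

End spatial.

(** * The anomaly of an action is a coboundary *)

Section cocycle_of_action.
Context (R : realType) (K : hilbertType R) (A : set (bop K)).
Hypothesis A1 : forall x y, A (rank_one x y).
Variable e : K.
Hypothesis e1 : `|e| = 1.
Context (G : groupType) (w : G -> G -> G -> R[i])
  (alpha : G -> bop K -> bop K) (m : G -> G -> multiplier K).
Hypothesis act : anomalous_action w A alpha m.
Variable U : G -> K -> K.
Hypothesis UP : forall g, implements A (U g) (alpha g).
Implicit Types (g h k : G) (x y : K) (S T : bop K).

Let M g h := mult_op e (m g h).

Let U_linear g : linear (U g). Proof. by case: (UP g). Qed.
Let U_dot g x y : hdot (U g x) (U g y) = hdot x y.
Proof. by case: (UP g). Qed.
Let U_surj g y : exists x, U g x = y. Proof. by case: (UP g). Qed.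
Let UE g T x (AT : A T) : alpha g T (U g x) = U g (T x).
Proof. by case: (UP g) => _ _ _; apply. Qed.

Let UZ g (c : R[i]) x : U g (c *: x) = c *: U g x.
Proof.
have U0 : U g 0 = 0.
  by apply: (addrI (U g 0)); have := U_linear g 1 0 0; rewrite !scale1r !addr0.
by have := U_linear g c x 0; rewrite U0 !addr0.
Qed.

Let U_inj g x y : U g x = U g y -> x = y.
Proof.
move=> xy; apply: (@hdot_inj _ _ x y) => z.
by rewrite -(U_dot g z x) xy U_dot.
Qed.

Let U0 g x : x != 0 -> U g x != 0.
Proof.
move=> x0; rewrite -(dnorm_eq0 hdot) U_dot.
by rewrite (dnorm_eq0 hdot).
Qed.

Let alphaA g T : A T -> A (alpha g T).
Proof.
by case: act => /(_ g)[[+ _ _] _ _ _ _] _ _ _ => h /h.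
Qed.

Let m_mul g h : is_multiplier A (m g h).
Proof. by case: act => _ /(_ g h)[]. Qed.

Let lE g h T x : A T -> lmul (m g h) T x = M g h (T x).
Proof. exact: lmulE. Qed.

Let rE g h T x : A T -> rmul (m g h) T x = T (M g h x).
Proof. exact: rmulE. Qed.

Let M_dot g h x y : hdot (M g h x) (M g h y) = hdot x y.
Proof. by apply: mult_op_isometry => //; case: act => _ /(_ g h). Qed.

Let MZ g h (c : R[i]) x : M g h (c *: x) = c *: M g h x.
Proof.
have Mlin := mult_op_linear A1 e1 (m_mul g h).
have M0 : M g h 0 = 0.
  by apply: (addrI (M g h 0)); have := Mlin 1 0 0; rewrite !scale1r !addr0.
by have := Mlin c x 0; rewrite -/(M g h) M0 !addr0.
Qed.

(** W = U_(gh)^-1 M_(g,h) U_g U_h commutes with every operator in A by axiom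
(1), hence is a scalar. *)
Lemma intertwining_scalar g h :
  exists c : R[i], forall x, M g h (U g (U h x)) = c *: U (g * h)%g x.
Proof.
pose W x := sval (cid (U_surj (g * h)%g (M g h (U g (U h x))))).
have WP x : U (g * h)%g (W x) = M g h (U g (U h x)) by rewrite /W; case: cid.
have [|c Wc] := @commutant_rank_one R K e e1 W; last first.
  by exists c => x; rewrite -WP Wc UZ.
move=> x y z; set T := rank_one x y.
have AT : A T by exact: A1.
apply: (@U_inj (g * h)%g); rewrite WP -(@UE h T _ AT).
rewrite -(@UE g _ _ (alphaA h AT)) -(@UE (g * h)%g T _ AT) WP.
rewrite -rE; last exact: alphaA.
case: act => _ _ /(_ g h T AT) <- _.
by rewrite lE//; do 2! apply: alphaA.
Qed.

Definition action_cochain g h : R[i] := sval (cid (intertwining_scalar g h)).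
Local Notation c := action_cochain.

Let cP g h x : M g h (U g (U h x)) = c g h *: U (g * h)%g x.
Proof. by rewrite /c; case: cid. Qed.

Lemma action_cochain_norm g h : `|c g h| = 1.
Proof.
apply/eqP; rewrite -(@pexpr_eq1 _ _ 2)//.
have := dnormZ hdot (c g h) (U (g * h)%g e).
by rewrite -cP M_dot !U_dot unit_vector_dot// mulr1 => <-.
Qed.

(** Axiom (2) with the extension of alpha_g to multipliers written out: it is
conjugation by U_g, so alpha_g(M_(h,k)) U_g = U_g M_(h,k). *)
Lemma associativity_mult_op g h k x :
  w g h k *: M (g * h)%g k (M g h (U g x)) = M g (h * k)%g (U g (M h k x)).
Proof.
case: act => aut _ _ /(_ g h k)[+ _].
(* Both sides are multipliers, compared on alpha_g(|x><e|) and then at U_g e,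
   where alpha_g(|x><e|) takes the value U_g x. *)
set T := rank_one x e; have AT : A T by exact: A1.
move=> /(_ (alpha g T) (mem_set (alphaA g AT))) /=.
have -> : 'pinv_(fun=> 0) A (alpha g) (alpha g T) = T.
  by apply: pinvKV; [case: (aut g) => -[]|exact: mem_set].
move=> /(congr1 (fun S : bop K => S (U g e))).
have lA g' h' T' : A T' -> A (lmul (m g' h') T').
  by case: (m_mul g' h') => + _ _ => /[apply].
rewrite bopZE lE//; last by apply: lA; exact: alphaA.
rewrite lE//; last exact: alphaA.
rewrite UE//.
rewrite lE//; last by apply: alphaA; exact: lA.
rewrite UE; last exact: lA.
rewrite lE//.
by rewrite rank_oneE unit_vector_dot// scale1r.
Qed.

(** Both sides are the scalar by which the two sides of axiom (2), applied to
U_g U_h U_k e, multiply U_(ghk) e. *)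
Lemma action_cochain_relation g h k :
  w g h k * (c g h * c (g * h)%g k) = c h k * c g (h * k)%g.
Proof.
have := associativity_mult_op g h k (U h (U k e)).
rewrite !cP UZ !MZ !cP !scalerA mulgA => /eqP.
rewrite -subr_eq0 -scalerBl scaler_eq0 orbC.
rewrite (negbTE (U0 _ _)) /=; last by rewrite -normr_eq0 e1 oner_eq0.
by rewrite subr_eq0 mulrA => /eqP.
Qed.

Hypothesis w_norm :
  forall g h k, [\/ g = 1%g, h = 1%g | k = 1%g] -> w g h k = 1.

Lemma anomaly_coboundary : coboundary3 w.
Proof.
have c0 g h : c g h != 0 by rewrite -normr_eq0 action_cochain_norm oner_eq0.
(* This is the relation for (g, 1, k), where w is trivial. *)
have c1 g k : c 1%g k = c g 1%g.
  have := action_cochain_relation g 1%g k.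
  rewrite w_norm; last by apply: Or32.
  by rewrite mul1g mulg1 mul1r => /(mulIf (c0 _ _)).
set l := c 1%g 1%g.
exists (fun g h => c g h / l).
  split=> [g h|g h [->|->]].
  - by rewrite normrM normfV !action_cochain_norm divr1.
  - by rewrite (c1 1%g h) divff.
  - by rewrite -(c1 g 1%g) divff.
move=> g h k; have := action_cochain_relation g h k.
move: (c0 g h) (c0 h k) (c0 (g * h)%g k) (c0 g (h * k)%g) (c0 1%g 1%g).
rewrite -/l => h1 h2 h3 h4 h5 E.
have -> : w g h k = c h k * c g (h * k)%g / (c g h * c (g * h)%g k).
  by rewrite -E mulfK// mulf_neq0.
by field; rewrite ?h1 ?h2 ?h3 ?h4 ?h5.
Qed.

End cocycle_of_action.

(** * The Roe algebra contains the rank-one operators *)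

Section rank_one_compact.
Context (R : realType) (K : hilbertType R).

Lemma real_complex_continuous : continuous (fun a : R => a%:C%C : R[i]^o).
Proof.
move=> a; apply/cvgrPdist_lt => /= eps eps0.
have epsE : eps = (complex.Re eps)%:C%C by rewrite RRe_real ?gtr0_real.
have eps0' : 0 < complex.Re eps by rewrite -ltcR -epsE.
have /cvgrPdist_lt /(_ _ eps0') := @cvg_id _ (nbhs a).
apply: filterS => b ab.
by rewrite -rmorphB /= normc_def /= expr0n addr0 sqrtr_sqr epsE ltcR.
Qed.

(** The unit ball is mapped into the image of a compact square of complex
numbers under c |-> c x. *)
Lemma rank_one_compact (x y : K) : compact_operator (rank_one x y).
Proof.
pose M := complex.Re `|y|.
pose f (ab : R * R) : K := (ab.1%:C%C + 'i%C * ab.2%:C%C : R[i]^o) *: x.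
have f_cont : continuous f.
  move=> ab; apply: cvgZ; last exact: cvg_cst.
  apply: cvgD.
    by apply: cvg_comp; [exact: cvg_fst|exact: real_complex_continuous].
  apply: cvgM; first exact: cvg_cst.
  apply: cvg_comp; [exact: cvg_snd|].
  exact: real_complex_continuous.
pose Q := (`[- M, M]%classic `*` `[- M, M]%classic).
have cQ : compact (f @` Q).
  apply: continuous_compact; first exact: continuous_subspaceT.
  by apply: compact_setX; exact: segment_compact.
apply: precompact_subset (compact_precompact (@norm_hausdorff _ _) cQ).
move=> _ [z /= z1 <-].
set c := hdot z y.
have cM : `|c| <= M%:C%C.
  rewrite -normReE (le_trans (hdot_le _ _))//.
  by rewrite ler_piMl.
exists (complex.Re c, complex.Im c); last by rewrite /f /= -complexE.
split; rewrite /= in_itv /= -ler_norml -lecR.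
  exact: le_trans (normc_ge_Re c) cM.
(* The imaginary part is bounded through Re (c i) = - Im c. *)
have := normc_ge_Re (c * 'i%C); rewrite ReiNIm normrN => /le_trans; apply.
rewrite normrM (_ : `|'i%C| = 1) ?mulr1//.
by rewrite normc_def /= expr0n expr1n add0r sqrtr1.
Qed.

End rank_one_compact.

Section rank_one_roe.
Context (R : realType) (X : metricType R) (H : hilbertType R).
Implicit Types (x y : X) (f g : l2 X H) (B : {fset X}).
#[local] Existing Instance summability.totally_filter.

Lemma adj_l2_proj x : adj (l2_proj H x) = l2_proj H x.
Proof.
apply: adj_unique => f g.
change (l2_dot (l2_proj H x f) g = l2_dot f (l2_proj H x g)).
apply: (congr1 (fun F : X -> R[i]^o => summability.sum F)).
apply/funext => y.
rewrite !l2_projE; case: ifP => // _.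
by rewrite linear0l linear0r.
Qed.

Definition l2_trunc B f : l2 X H := \sum_(x <- B) l2_proj H x f.

Lemma l2_truncE B f x : l2_trunc B f x = if x \in B then f x else 0.
Proof.
rewrite /l2_trunc.
have -> : (\sum_(y <- B) l2_proj H y f) x = \sum_(y <- B) l2_proj H y f x.
  by elim/big_rec2: _ => // y u v _ <-.
case: ifPn => xB; last first.
  rewrite big_seq big1// => y yB; rewrite l2_projE.
  by case: eqP => // xy; rewrite xy yB in xB.
rewrite (big_fsetD1 x)// l2_projE eqxx big_seq big1 => [|y]; first exact: addr0.
by rewrite !inE l2_projE eq_sym => /andP[/negbTE ->].
Qed.

Lemma l2_trunc_complE B f x :
  (f - l2_trunc B f : l2 X H) x = if x \in B then 0 else f x.
Proof.
change (f x - l2_trunc B f x = if x \in B then 0 else f x).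
by rewrite l2_truncE; case: ifP => _; rewrite ?subrr ?subr0.
Qed.

Lemma l2_trunc_le B f : `|l2_trunc B f| <= `|f|.
Proof.
apply: l2_norm_le => // A; apply: le_trans (l2_psum_le f A).
rewrite !psumE ler_sum// => x _; rewrite l2_truncE.
by case: ifP => // _; rewrite normr0 expr0n exprn_ge0.
Qed.

(** The squared norm of f is the limit of its finite partial sums, and the part
of f outside B contributes only the tail beyond B. *)
Lemma l2_trunc_dense f (eps : R[i]) : 0 < eps ->
  exists B, `|f - l2_trunc B f| <= eps.
Proof.
move=> eps0; have eps2 : 0 < eps ^+ 2 by rewrite exprn_gt0.
have := @l2_dot_sq_cvg R X H f; rewrite l2_dotE.
move=> /cvgrPdist_lt /(_ _ eps2) [B _ /(_ B (fsubset_refl B))] /= fB.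
exists B; apply: l2_norm_le => [|A]; first exact: ltW.
apply: le_trans (ltW fB); rewrite ger0_norm; last first.
  by rewrite subr_ge0 l2_psum_le.
rewrite lerBrDr; apply: le_trans (l2_psum_le f (A `|` B)%fset).
rewrite !psumE.
rewrite (big_fsetID _ (mem B) (A `|` B)%fset) /= addrC.
rewrite (_ : [fset x | x in (A `|` B)%fset & x \in B]%fset = B); last first.
  by apply/fsetP => x; rewrite !inE /=; case: (x \in B); rewrite ?orbT ?andbF.
rewrite lerD2r.
rewrite (big_fsetID _ (mem B) A) /= [X in X + _]big_seq big1 ?add0r.
  rewrite (_ : [fset x | x in (A `|` B)%fset & x \notin B]%fset =
               [fset x | x in A & x \notin B]%fset).
    rewrite big_seq [leRHS]big_seq ler_sum// => x; rewrite !inE => /andP[_ xB].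
    have := l2_trunc_complE B f x; rewrite (negbTE xB) => fx.
    by rewrite [_ x]fx.
  by apply/fsetP => x; rewrite !inE /=; case: (x \in B); rewrite ?andbF ?orbF.
move=> x; rewrite !inE => /andP[_ xB].
have := l2_trunc_complE B f x; rewrite xB => fx.
by rewrite [_ x]fx normr0 expr0n.
Qed.

(** Only the finitely many pairs of points in the two supports contribute, so
the sum of their distances (plus one, for strictness) bounds the propagation. *)
Lemma rank_one_trunc_propagation B C f g :
  finite_propagation (rank_one (l2_trunc B f) (l2_trunc C g)).
Proof.
pose r := \sum_(y <- B) \sum_(x <- C) mdist x y.
have r0 : 0 <= r by do 2 (apply: sumr_ge0 => ? _); exact: mdist_ge0.
exists (r + 1); first exact: ltr_wpDl.
move=> x y; rewrite mul_rank_one rank_one_mul adj_l2_proj => nz.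
have xC : x \in C.
  apply: contraNT nz => xC; apply/eqP/bop_ext => z; rewrite rank_oneE.
  suff -> : l2_proj H x (l2_trunc C g) = 0 by rewrite linear0r scale0r.
  apply: l2_ext => u; rewrite l2_projE; case: eqP => // ->.
  by rewrite l2_truncE (negbTE xC).
have yB : y \in B.
  apply: contraNT nz => yB; apply/eqP/bop_ext => z; rewrite rank_oneE.
  suff -> : l2_proj H y (l2_trunc B f) = 0 by rewrite scaler0.
  apply: l2_ext => u; rewrite l2_projE; case: eqP => // ->.
  by rewrite l2_truncE (negbTE yB).
rewrite ltr_pwDr// /r (big_fsetD1 y)//= (big_fsetD1 x)//= -addrA lerDl.
rewrite addr_ge0//; first by apply: sumr_ge0 => ? _; exact: mdist_ge0.
by do 2 (apply: sumr_ge0 => ? _); exact: mdist_ge0.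
Qed.

(** Truncating both vectors to finite sets of points gives locally compact
operators of finite propagation that approximate |f><g| in norm. *)
Lemma rank_one_roe f g : roe_algebra (rank_one f g).
Proof.
move=> N /nbhs_ballP[eps /= eps0 epsN].
pose d := eps / (`|f| + `|g| + 1).
have s0 : 0 < `|f| + `|g| + 1 by rewrite ltr_wpDl// addr_ge0.
have d0 : 0 < d by rewrite divr_gt0.
have [B fB] := l2_trunc_dense f d0; have [C gC] := l2_trunc_dense g d0.
exists (rank_one (l2_trunc B f) (l2_trunc C g)); split.
  split; last exact: rank_one_trunc_propagation.
  by move=> x y; rewrite mul_rank_one rank_one_mul; exact: rank_one_compact.
apply: epsN; apply/ball_normP.
have -> : rank_one f g - rank_one (l2_trunc B f) (l2_trunc C g) =
    rank_one (f - l2_trunc B f) g + rank_one (l2_trunc B f) (g - l2_trunc C g).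
  by rewrite rank_oneBl rank_oneBr addrA subrK.
apply: (@le_lt_trans _ _ (d * (`|f| + `|g|))).
  rewrite (le_trans (ler_normD _ _))// mulrDr addrC lerD//.
    rewrite (le_trans (rank_one_norm _ _))// mulrC.
    by rewrite ler_pM ?l2_trunc_le.
  by rewrite (le_trans (rank_one_norm _ _))// ler_wpM2r.
by rewrite /d mulrAC ltr_pdivrMr// ltr_pM2l// ltrDl.
Qed.

End rank_one_roe.

(** * Anomalous actions on Roe algebras *)

Lemma infinite_dimensional_neq0 (R : realType) (H : hilbertType R) :
  ~ finite_dimensional H -> exists v : H, v != 0.
Proof.
move=> Hinf; apply: contrapT => /forallNP H0; apply: Hinf.
exists 0%N, (fun=> 0) => v; exists (fun=> 0); rewrite big_ord0.
by have /negP := H0 v; rewrite negbK => /eqP.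
Qed.

Lemma l2_delta_summable (R : realType) (X : choiceType) (H : hilbertType R)
    (x : X) (v : H) :
  (fun y => if y == x then v else 0) \in @square_summable R X H.
Proof.
apply/square_summableP; exists (`|v| ^+ 2) => A; rewrite psumE.
have [xA|xA] := boolP (x \in A).
  rewrite (big_fsetD1 x)//= eqxx big_seq big1 ?addr0// => y.
  by rewrite !inE => /andP[/negbTE ->]; rewrite normr0 expr0n.
rewrite big_seq big1 ?exprn_ge0// => y yA.
by case: eqP => [yx|]; [rewrite yx (negbTE xA) in yA|rewrite normr0 expr0n].
Qed.

Theorem theorem1p4 (R : realType) (X : metricType R) (H : hilbertType R)
    (X_nonempty : [set: X] !=set0)
    (X_discrete : forall x : X, open [set x])
    (X_bounded_geometry : bounded_geometry X)
    (H_separable : separable H)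
    (H_infinite_dimensional : ~ finite_dimensional H)
    (G : groupType) (w : G -> G -> G -> R[i])
    (w_cocycle : cocycle3 w) (w_nontrivial : ~ coboundary3 w) :
  ~ exists (alpha : G -> bop (l2 X H) -> bop (l2 X H))
           (m : G -> G -> multiplier (l2 X H)),
      anomalous_action w (@roe_algebra R X H) alpha m.
Proof.
move=> [alpha [m act]]; apply: w_nontrivial.
have [x _] := X_nonempty.
have [v v0] := infinite_dimensional_neq0 H_infinite_dimensional.
pose f : l2 X H := L2 (l2_delta_summable x v).
have f0 : f != 0.
  apply: contraNneq v0 => f0.
  by have := congr1 (fun h : l2 X H => h x) f0; rewrite /= eqxx => ->.
pose e := `|f|^-1 *: f.
have e1 : `|e| = 1 by rewrite normrZ normfV normr_id mulVf ?normr_eq0.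
have A1 := @rank_one_roe R X H.
have spatial g : exists U, implements (@roe_algebra R X H) U (alpha g).
  by apply: (automorphism_spatial A1 e1); case: act.
have UP g := svalP (cid (spatial g)).
by case: w_cocycle => _ w1 _; exact: (anomaly_coboundary A1 e1 act UP w1).
Qed.
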